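(* Let $N\ge 4$ be an integer, let $p\in\mathbb{Z}\setminus\{0,1,-1\}$, and let $a,b\in\mathbb{R}$ with $ab\neq 0$. Then there exist real force coefficients $\kappa_1,\dots,\kappa_{\lfloor N/2\rfloor}$ such that the $N$-body choreographic motion $(q_0,\dots,q_{N-1})$ on the $p$-limaçon curve $q(t)=a(\cos t,\sin t)+b(\cos pt,\sin pt)$ satisfies the equations of motion $$\ddot q_j=\sum_{l\neq j}\kappa_{jl}(q_l-q_j),\qquad j=0,1,\dots,N-1,$$ for all $t\in\mathbb{R}$, if and only if $$\frac{p}{N}\notin\mathbb{Z},\qquad \frac{p+1}{N}\notin\mathbb{Z},\qquad \frac{p-1}{N}\notin\mathbb{Z}.$$
   Context: The $p$-limaçon curve with parameters $a,b$ is $q(t)=a(\cos t,\sin t)+b(\cos pt,\sin pt)\in\mathbb{R}^2$. The $N$-body choreographic motion on it is $q_k(t)=q\left(t+\frac{2\pi k}{N}\right)$, $k=0,1,\dots,N-1$ (all masses equal $1$; collisions are allowed). The potential is $V=\frac12\sum_{j<l}\kappa_{jl}|q_j-q_l|^2$ with $\kappa_{jl}=\kappa_{lj}\in\mathbb{R}$, and it is assumed $Z_N$-symmetric: for $j\ne l$, $\kappa_{jl}=\kappa_d$ where $d=\min(|j-l|,N-|j-l|)\in\{1,\dots,\lfloor N/2\rfloor\}$. The equations of motion are $\ddot q_j=-\partial V/\partial q_j$. *)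

(* Defs.v *)
From HB Require Import structures.
From mathcomp Require Import all_boot all_order all_algebra.
From mathcomp Require Import all_classical all_reals all_analysis.

Set Implicit Arguments.
Unset Strict Implicit.
Unset Printing Implicit Defensive.

Import Order.TTheory GRing.Theory Num.Theory.
Import numFieldNormedType.Exports.

Local Open Scope ring_scope.

Definition circle_pt (R : realType) (t : R) : 'rV[R]_2 :=
  \row_(i < 2) (if i == 0 then cos t else sin t).

Definition limacon (R : realType) (p : int) (a b : R) (t : R) : 'rV[R]_2 :=
  a *: circle_pt t + b *: circle_pt (p%:~R * t).

Definition choreography (R : realType) (N : nat) (q : R -> 'rV[R]_2)
    (k : 'I_N) (t : R) : 'rV[R]_2 :=
  q (t + 2 * pi * k%:R / N%:R).

Definition cyc_dist (N : nat) (j l : 'I_N) : nat :=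
  let d := `|j%:Z - l%:Z|%N in minn d (N - d)%N.

(* The coefficients are indexed by [nat], but for [j != l] only the values at
   [1 <= d <= N./2] occur. *)
Definition force_coef (R : realType) (N : nat) (kappa : nat -> R)
    (j l : 'I_N) : R :=
  kappa (cyc_dist j l).

(* [derive1n] is total, so differentiability is required separately. *)
Definition equations_of_motion (R : realType) (N : nat)
    (K : 'I_N -> 'I_N -> R) (q : 'I_N -> R -> 'rV[R]_2) : Prop :=
  forall (j : 'I_N) (t : R),
    [/\ derivable (q j) t 1,
        derivable ((q j)^`())%classic t 1 &
        ((q j)^`(2))%classic t = \sum_(l < N | l != j) K j l *: (q l t - q j t)].

(* Main.v *)
Require Import Defs.
From HB Require Import structures.
From mathcomp Require Import all_boot all_order all_algebra.
From mathcomp Require Import all_classical all_reals all_analysis.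
From mathcomp Require Import ring lra zify.

Set Implicit Arguments.
Unset Strict Implicit.
Unset Printing Implicit Defensive.

Import Order.TTheory GRing.Theory Num.Theory.
Import numFieldNormedType.Exports.

Local Open Scope ring_scope.

(** A Z_N-symmetric force is a circulant matrix, so it is diagonalised by the
    discrete Fourier modes.  Write u for the unit circle and w_d = 2 pi d / N.
    A limacon is the superposition a u(s) + b u(p s) of two harmonics, and the
    body at phase s feels from its neighbours at phases s + w_d and s - w_d,
    on the harmonic m, the sum u(m s + m w_d) + u(m s - m w_d), which is the
    multiple 2 cos (m w_d) of u(m s).  Hence the total force on the harmonic m
    is - lambda_m u(m s), where

      lambda_m = sum_d kappa_d (1 - cos (m w_d))

    ([force_circle_pt]).  The acceleration is - a u(s) - b p^2 u(p s), and
    s |-> u(s) and s |-> u(p s) are linearly independent for p <> 1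
    ([circle_pt_free]), so the equations of motion say exactly that
    lambda_1 = 1 and lambda_p = p^2 ([equations_of_motion_limacon]).

    What remains is to decide which pairs (lambda_1, lambda_p) are attained.
    Now lambda_m is even in m and depends only on m modulo N.  If N divides p
    then lambda_p = lambda_0 = 0 <> p^2; if N divides p + 1 or p - 1 then
    lambda_p = lambda_1 = 1 <> p^2.  In all other cases the cosine vectors
    (cos (w_d))_d and (cos (p w_d))_d over Z/N are orthogonal to each other and
    to the constants, so a suitable combination of the two is a kappa with any
    prescribed pair of eigenvalues ([circ_eig_prescribe]).  Such a combination
    is invariant under d |-> N - d, as a coefficient depending on the cyclic
    distance has to be. *)

(** * Harmonics on the regular N-gon *)

Section Harmonics.
Variable R : realType.
Implicit Types (x y t : R) (m : int).

Lemma cosDz2pi x (z : int) : cos (x + z%:~R * (2 * pi)) = cos x :> R.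
Proof.
have -> : z%:~R * (2 * pi) = (pi *+ 2) *~ z :> R by rewrite mulr_natl mulrzl.
case: z => n; first exact: periodicn (@cosD2pi R) n x.
by rewrite NegzE mulrNz -(periodicn (@cosD2pi R) n.+1) subrK.
Qed.

Lemma sinDz2pi x (z : int) : sin (x + z%:~R * (2 * pi)) = sin x :> R.
Proof. by rewrite -!cosBpihalf addrAC cosDz2pi. Qed.

Lemma circle_ptDz2pi x (z : int) :
  circle_pt (x + z%:~R * (2 * pi)) = circle_pt x.
Proof. by apply/rowP => i; rewrite !mxE cosDz2pi sinDz2pi. Qed.

Lemma circle_ptDB x y :
  circle_pt (x + y) + circle_pt (x - y) = (2 * cos y) *: circle_pt x.
Proof.
apply/rowP => i; rewrite !mxE.
by case: ifP => _; rewrite !(cosB, sinB, cosD, sinD); ring.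
Qed.

(** The phase shift of the body [k], in the form in which it occurs in
    [choreography]. *)
Definition node (N : nat) (k : nat) : R := 2 * pi * k%:R / N%:R.

Lemma cos_node_dvdz (N k : nat) (m m' : int) : (0 < N)%N ->
  (N%:Z %| m - m')%Z -> cos (m%:~R * node N k) = cos (m'%:~R * node N k).
Proof.
move=> N_gt0 /dvdzP[c mE]; have {mE}-> : m = m' + c * N%:Z by lia.
rewrite -[RHS](cosDz2pi _ (c * k%:Z)); congr cos.
rewrite /node rmorphD !rmorphM /= -!pmulrn.
by field; rewrite pnatr_eq0 -lt0n.
Qed.

Lemma circle_pt_node_mod (N k : nat) m t : (0 < N)%N ->
  circle_pt (m%:~R * (t + node N (k %% N))) =
  circle_pt (m%:~R * (t + node N k)).
Proof.
move=> N_gt0; rewrite -[LHS](circle_ptDz2pi _ (m * (k %/ N)%:Z)).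
congr circle_pt; rewrite /node {3}(divn_eq k N) natrD natrM rmorphM /= -!pmulrn.
by field; rewrite pnatr_eq0 -lt0n.
Qed.

(** Orthogonality of a nontrivial character of Z/N to the trivial one, in real
    form.  After multiplication by 2 sin (r pi / N), where r is the residue of
    [m], the sum telescopes; the factor is nonzero because 0 < r < N. *)
Lemma sum_cos_node (N : nat) m : (0 < N)%N -> ~~ (N%:Z %| m)%Z ->
  \sum_(k < N) cos (m%:~R * node N k) = 0.
Proof.
move=> N_gt0 mN.
have NR : N%:R != 0 :> R by rewrite pnatr_eq0 -lt0n.
pose r := `|(m %% N%:Z)%Z|%N.
have rE : r%:Z = (m %% N%:Z)%Z by rewrite /r gez0_abs // modz_ge0 //; lia.
have r_gt0 : (0 < r)%N.
  rewrite lt0n; apply: contra mN => /eqP r0; apply/dvdz_mod0P.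
  by rewrite -rE r0.
have r_ltN : (r < N)%N by rewrite -ltz_nat rE ltz_pmod //; lia.
pose h : R := r%:R * pi / N%:R.
have h_neq0 : 2 * sin h != 0.
  rewrite mulf_neq0 ?pnatr_eq0 // gt_eqF // sin_gt0_pi // /h.
  rewrite divr_gt0 ?mulr_gt0 ?pi_gt0 ?ltr0n //=.
  by rewrite ltr_pdivrMr ?ltr0n // mulrC ltr_pM2l ?pi_gt0 // ltr_nat.
apply: (mulfI h_neq0); rewrite mulr0 mulr_sumr.
pose f (k : nat) := sin (r%:R * node N k - h).
rewrite (eq_bigr (fun k : 'I_N => f k.+1 - f k)); last first.
  move=> k _; rewrite (@cos_node_dvdz N k m r) //; last first.
    by rewrite rE {1}(divz_eq m N%:Z) addrK dvdz_mull.
  rewrite /f (_ : r%:R * node N k.+1 - h = r%:R * node N k + h).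
    by rewrite sinD sinB -pmulrn; ring.
  by rewrite /h /node -natr1; field.
rewrite -(big_mkord xpredT (fun k => f k.+1 - f k)) telescope_sumr // /f.
apply/eqP; rewrite subr_eq0; apply/eqP.
rewrite -[RHS](sinDz2pi _ r%:Z) -pmulrn; congr sin.
by rewrite /node /h; field.
Qed.

(** * The circulant force acts on each harmonic as a scalar *)

(** The eigenvalue, up to sign, of the circulant force on the harmonic [m]; the
    index [minn d (N - d)] makes the sum range over all of Z/N, the term [d = 0]
    being zero. *)
Definition circ_eig (N : nat) (kappa : nat -> R) m : R :=
  \sum_(d < N) kappa (minn d (N - d)) * (1 - cos (m%:~R * node N d)).

Lemma circ_eig_dvdz (N : nat) kappa (m m' : int) : (0 < N)%N ->
  (N%:Z %| m - m')%Z -> circ_eig N kappa m = circ_eig N kappa m'.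
Proof.
by move=> N_gt0 mm'; apply: eq_bigr => d _; rewrite (cos_node_dvdz _ N_gt0 mm').
Qed.

Lemma circ_eigN N kappa m : circ_eig N kappa (- m) = circ_eig N kappa m.
Proof. by apply: eq_bigr => d _; rewrite rmorphN mulNr cosN. Qed.

Lemma cyc_distD n (j d : 'I_n.+1) : cyc_dist j (d + j) = minn d (n.+1 - d).
Proof.
rewrite /cyc_dist /=.
move: (nat_of_ord d) (nat_of_ord j) (ltn_ord d) (ltn_ord j) => {d}d {j}j dN jN.
have [dj|dj] := ltnP (d + j) n.+1; first by rewrite modn_small //; lia.
by rewrite -(subnK dj) modnDr modn_small; lia.
Qed.

(** Reindexing by the difference [d = l - j] in Z/N makes the coefficient
    independent of [j].  Since it is also even in [d], averaging the sum with
    its image under [d |-> - d] replaces u(x + y) by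
    (u(x + y) + u(x - y)) / 2 = cos y u(x). *)
Lemma force_circle_pt (N : nat) kappa m (j : 'I_N) t :
  \sum_(l < N | l != j) force_coef kappa j l *:
     (circle_pt (m%:~R * (t + node N l)) - circle_pt (m%:~R * (t + node N j)))
  = - circ_eig N kappa m *: circle_pt (m%:~R * (t + node N j)).
Proof.
case: N j => [|n] j; first by case: j.
set N := n.+1; set s := t + node N j.
have N_gt0 : (0 < N)%N by [].
pose c (d : 'I_N) := kappa (minn d (N - d)).
pose u (d : 'I_N) := circle_pt (m%:~R * s + m%:~R * node N d).
pose v (d : 'I_N) := circle_pt (m%:~R * s - m%:~R * node N d).
pose w := circle_pt (m%:~R * s).
have cE (d : 'I_N) : force_coef kappa j (d + j) = c d.
  by rewrite /force_coef cyc_distD.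
have -> : \sum_(l < N | l != j) force_coef kappa j l *:
     (circle_pt (m%:~R * (t + node N l)) - w) = \sum_d c d *: (u d - w).
  rewrite big_mkcond (reindex_inj (addIr j)) /=; apply: eq_bigr => d _.
  rewrite cE [_ != _](_ : _ = (d != 0)); last first.
    by rewrite -subr_eq0 addrK.
  have [->|_] /= := eqVneq d 0.
    by rewrite /u /node /= mulr0 mul0r mulr0 addr0 subrr scaler0.
  rewrite (circle_pt_node_mod (d + j)) // /u /s -mulrDr.
  congr (_ *: (circle_pt _ - _)).
  by rewrite /node natrD; ring.
have refl : \sum_d c d *: (u d - w) = \sum_d c d *: (v d - w).
  rewrite (reindex_inj oppr_inj) /=; apply: eq_bigr => d _; congr (_ *: (_ - _)).
    rewrite /c /=; congr kappa; have := ltn_ord d; rewrite /N => dN.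
    have [d0|d0] := posnP d; first by rewrite d0 subn0 modnn; lia.
    by rewrite modn_small; lia.
  rewrite /u /v /= -mulrDr circle_pt_node_mod //.
  rewrite -[LHS](circle_ptDz2pi _ (- m)); congr circle_pt.
  rewrite /node natrB ?(ltnW (ltn_ord _)) // rmorphN /= -/N.
  by field; rewrite pnatr_eq0.
apply: (@scalerI _ _ 2); first by rewrite pnatr_eq0.
transitivity (\sum_d c d *: (u d - w) + \sum_d c d *: (v d - w)).
  by rewrite -refl -[2]/(1 + 1 : R) scalerDl scale1r.
rewrite -big_split /= scalerA mulrN -mulNr /circ_eig mulr_sumr scaler_suml.
apply: eq_bigr => d _; rewrite -scalerDr addrACA circle_ptDB -/w.
by rewrite /c; apply/rowP => i; rewrite !mxE; ring.
Qed.

End Harmonics.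

(** * Equations of motion as conditions on two eigenvalues *)

Section Motion.
Variable R : realType.
Implicit Types (a b c x t : R) (p : int).

Lemma limaconE p a b t :
  limacon p a b t = a *: circle_pt (1%:~R * t) + b *: circle_pt (p%:~R * t).
Proof. by rewrite /limacon mul1r. Qed.

Lemma choreographyE (N : nat) (q : R -> 'rV[R]_2) (k : 'I_N) :
  choreography q k = fun t => q (t + node R N k).
Proof. by []. Qed.

Lemma sum_force_limacon (N : nat) kappa p a b (j : 'I_N) t :
  let q := choreography (limacon p a b) in
  \sum_(l < N | l != j) force_coef kappa j l *: (q l t - q j t) =
  - (a * circ_eig N kappa 1) *: circle_pt (t + node R N j)
  - (b * circ_eig N kappa p) *: circle_pt (p%:~R * (t + node R N j)).
Proof.
move=> q.
have F := fun m => force_circle_pt kappa m j t.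
transitivity (a *: (- circ_eig N kappa 1 *: circle_pt (1%:~R * (t + node R N j)))
  + b *: (- circ_eig N kappa p *: circle_pt (p%:~R * (t + node R N j)))).
  rewrite -!F !scaler_sumr -big_split.
  apply: eq_bigr => l _; rewrite /q !choreographyE !limaconE.
  by apply/rowP => i; rewrite !mxE; ring.
by rewrite mul1r; apply/rowP => i; rewrite !mxE; ring.
Qed.

(** Differentiating the unit circle advances the phase by a quarter turn; in
    this form differentiation can be iterated. *)
Lemma is_derive_circle_pt (h : R -> R) t c : is_derive t 1 h c ->
  is_derive t 1 (fun x => circle_pt (h x)) (c *: circle_pt (h t + pi / 2)).
Proof.
move=> dh.
have E (j : 'I_2) : is_derive t 1 (fun x => circle_pt (h x) 0 j)
    ((c *: circle_pt (h t + pi / 2)) 0 j).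
  under eq_fun do rewrite mxE; rewrite !mxE; case: (j == 0).
    by rewrite cosDpihalf mulrC; exact: (is_derive1_comp _ dh).
  by rewrite sinDpihalf mulrC; exact: (is_derive1_comp _ dh).
have D : derivable (fun x => circle_pt (h x)) t 1.
  by apply/derivable_mxP => i j; rewrite ord1; exact: (@ex_derive _ _ _ _ _ _ _ (E j)).
apply: DeriveDef => //; rewrite derive_mx //.
by apply/matrixP => i j; rewrite ord1 mxE (@derive_val _ _ _ _ _ _ _ (E j)).
Qed.

(** The phase [e], common to both harmonics, and the free amplitude [b] let the
    same statement serve for the velocity and for the acceleration. *)
Lemma is_derive_two_circles p a b d e t :
  is_derive t 1
    (fun x => a *: circle_pt (x + d + e) + b *: circle_pt (p%:~R * (x + d) + e))
    (a *: circle_pt (t + d + (e + pi / 2)) +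
     (b * p%:~R) *: circle_pt (p%:~R * (t + d) + (e + pi / 2))).
Proof.
have d1 : is_derive t 1 (fun x => x + d + e) 1.
  by apply: is_derive_eq; rewrite !addr0.
have dp : is_derive t 1 (fun x => p%:~R * (x + d) + e) p%:~R.
  by apply: is_derive_eq; rewrite !addr0 /GRing.scale /= mulr1.
have := is_derive_circle_pt d1; have := is_derive_circle_pt dp.
move=> {d1}dp {}d1; apply: is_derive_eq.
by rewrite scale1r scalerA !addrA.
Qed.

Lemma limacon_derive2 p a b (N : nat) (j : 'I_N) t :
  let q := choreography (limacon p a b) j in
  [/\ derivable q t 1, derivable (q^`())%classic t 1 &
      (q^`(2))%classic t = - a *: circle_pt (t + node R N j)
        - (b * p%:~R ^+ 2) *: circle_pt (p%:~R * (t + node R N j))].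
Proof.
move=> q; pose d := node R N j.
have qE : q = fun x =>
    a *: circle_pt (x + d + 0) + b *: circle_pt (p%:~R * (x + d) + 0).
  by apply/funext => x; rewrite /q choreographyE /limacon !addr0.
pose D x := is_derive_two_circles p a b d 0 x.
pose D2 x := is_derive_two_circles p a (b * p%:~R) d (0 + pi / 2) x.
have q'E : (q^`())%classic = fun x => a *: circle_pt (x + d + (0 + pi / 2)) +
     (b * p%:~R) *: circle_pt (p%:~R * (x + d) + (0 + pi / 2)).
  by apply/funext => x; rewrite derive1E qE (@derive_val _ _ _ _ _ _ _ (D x)).
have uDpi x : circle_pt (x + (0 + pi / 2 + pi / 2)) = - circle_pt x.
  rewrite add0r -splitr; apply/rowP => i; rewrite !mxE.
  by rewrite cosDpi sinDpi; case: ifP.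
split; first by rewrite qE; exact: (@ex_derive _ _ _ _ _ _ _ (D t)).
  by rewrite q'E; exact: (@ex_derive _ _ _ _ _ _ _ (D2 t)).
rewrite derive1nS derive1n1 q'E derive1E (@derive_val _ _ _ _ _ _ _ (D2 t)).
by rewrite !uDpi -mulrA -expr2 !scalerN scaleNr.
Qed.

(** At s = 0 the relation gives A + B = 0.  At s = pi / (p - 1) the two harmonics
    are in opposite phase, p s = s + pi, and it gives A - B = 0. *)
Lemma circle_pt_free p (A B : R) : p != 1 ->
  (forall s, A *: circle_pt s + B *: circle_pt (p%:~R * s) = 0) ->
  A = 0 /\ B = 0.
Proof.
move=> p1 AB0.
have p1R : p%:~R - 1 != 0 :> R by rewrite subr_eq0 -[1]/(1%:~R) eqr_int.
have AB : A + B = 0.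
  have /rowP/(_ 0) := AB0 0.
  by rewrite !mxE mulr0 /= cos0 !mulr1.
pose s : R := pi / (p%:~R - 1).
have psE : p%:~R * s = s + pi by rewrite /s; field.
have /rowP sE := AB0 s.
have := sE 0; have := sE 1; rewrite !mxE psE /= cosDpi sinDpi => sin_s cos_s.
have A0 : A = 0.
  have E : A - B = 0.
    rewrite -[LHS]mulr1 -(cos2Dsin2 s).
    transitivity ((A * cos s + B * - cos s) * cos s +
                  (A * sin s + B * - sin s) * sin s); first by ring.
    by rewrite sin_s cos_s !mul0r addr0.
  lra.
by split=> //; rewrite -AB A0 add0r.
Qed.

(** Both sides of the equations of motion are combinations of the same two
    harmonics, so the equations reduce to comparing coefficients. *)
Lemma equations_of_motion_limacon (N : nat) kappa p a b :
  (0 < N)%N -> p != 1 -> a != 0 -> b != 0 ->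
  equations_of_motion (@force_coef R N kappa) (choreography (limacon p a b)) <->
  circ_eig N kappa 1 = 1 /\ circ_eig N kappa p = p%:~R ^+ 2.
Proof.
move=> N_gt0 p1 a0 b0; split=> [eom|[l1 lp] j t]; last first.
  have [D1 D2 ->] := limacon_derive2 p a b j t.
  by split=> //; rewrite sum_force_limacon l1 lp mulr1.
pose j := Ordinal N_gt0.
suff [A0 B0] : a * (circ_eig N kappa 1 - 1) = 0 /\
               b * (circ_eig N kappa p - p%:~R ^+ 2) = 0.
  split; apply/eqP; rewrite -subr_eq0.
    by move/eqP: A0; rewrite mulf_eq0 (negPf a0).
  by move/eqP: B0; rewrite mulf_eq0 (negPf b0).
apply: (circle_pt_free p1) => s.
have [_ _] := eom j (s - node R N j); rewrite sum_force_limacon.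
have [_ _ ->] := limacon_derive2 p a b j (s - node R N j).
rewrite subrK => /eqP; rewrite -subr_eq0 => /eqP <-.
by apply/rowP => i; rewrite !mxE; ring.
Qed.

End Motion.

(** * Prescribing two eigenvalues *)

Section Prescribe.
Variables (R : realType) (N : nat).
Hypothesis N_gt0 : (0 < N)%N.
Implicit Types (m : int) (x y : R).

Lemma cos_node_minn m (k : nat) : (k <= N)%N ->
  cos (m%:~R * node R N (minn k (N - k))) = cos (m%:~R * node R N k).
Proof.
move=> kN; rewrite /minn; case: ifP => // _.
rewrite -cosN -[LHS](cosDz2pi _ m); congr cos.
by rewrite /node natrB //; field; rewrite pnatr_eq0 -lt0n.
Qed.

Lemma sum_cos_node_orth m m' :
  ~~ (N%:Z %| m + m')%Z -> ~~ (N%:Z %| m - m')%Z ->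
  \sum_(k < N) cos (m%:~R * node R N k) * cos (m'%:~R * node R N k) = 0.
Proof.
move=> mDm' mBm'; apply: (@mulfI _ 2); first by rewrite pnatr_eq0.
rewrite mulr0 mulr_sumr.
transitivity (\sum_(k < N) cos ((m + m')%:~R * node R N k) +
              \sum_(k < N) cos ((m - m')%:~R * node R N k)).
  rewrite -big_split; apply: eq_bigr => k _ /=.
  by rewrite rmorphB rmorphD /= mulrBl (mulrDl m%:~R) cosB cosD; ring.
by rewrite !sum_cos_node ?addr0.
Qed.

Lemma sum_cos_node_sqr_neq0 m :
  \sum_(k < N) cos (m%:~R * node R N k) * cos (m%:~R * node R N k) != 0.
Proof.
rewrite psumr_neq0 => [|k _]; last by rewrite -expr2 sqr_ge0.
apply/hasP; exists (Ordinal N_gt0); first by rewrite mem_index_enum.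
by rewrite /node /= mulr0 mul0r mulr0 cos0 mulr1 ltr01.
Qed.

(** The coefficient vector is sought in the span of the two cosine vectors.  It
    is orthogonal to the constants, which leaves
    lambda_n = - sum_d kappa_d cos (n w_d); the two cosine vectors being
    orthogonal, their coefficients are fixed independently of each other.
    Dividing by the squared norm [S n], rather than by N / 2, covers the case
    where N divides 2 n, in which it equals N. *)
Lemma circ_eig_prescribe m m' x y :
  [&& ~~ (N%:Z %| m)%Z, ~~ (N%:Z %| m')%Z, ~~ (N%:Z %| m + m')%Z &
      ~~ (N%:Z %| m - m')%Z] ->
  exists kappa, circ_eig N kappa m = x /\ circ_eig N kappa m' = y.
Proof.
case/and4P=> mN m'N mDm' mBm'.
pose c n k := cos (n%:~R * node R N k).
pose S n := \sum_(k < N) c n k * c n k.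
pose al := - x / S m; pose be := - y / S m'.
exists (fun k => al * c m k + be * c m' k).
have eigE n : circ_eig N (fun k => al * c m k + be * c m' k) n =
    - (al * \sum_(k < N) c m k * c n k + be * \sum_(k < N) c m' k * c n k).
  transitivity (al * \sum_(k < N) c m k + be * \sum_(k < N) c m' k
    - (al * \sum_(k < N) c m k * c n k + be * \sum_(k < N) c m' k * c n k)).
    rewrite !mulr_sumr -!big_split -sumrB; apply: eq_bigr => k _ /=.
    rewrite /c !cos_node_minn ?(ltnW (ltn_ord _)) //; ring.
  by rewrite !sum_cos_node // !mulr0 addr0 add0r.
have m'Bm : ~~ (N%:Z %| m' - m)%Z by rewrite -opprB rpredN.
have m'Dm : ~~ (N%:Z %| m' + m)%Z by rewrite addrC.
rewrite !eigE (sum_cos_node_orth mDm' mBm') (sum_cos_node_orth m'Dm m'Bm).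
by rewrite !mulr0 addr0 add0r /al /be -/(S m) -/(S m') !mulNr !divfK ?opprK //;
  exact: sum_cos_node_sqr_neq0.
Qed.
End Prescribe.

(** * The criterion *)

Lemma Qint_divz (m : int) (n : nat) : (0 < n)%N ->
  ((m%:~R / n%:R : rat) \is a Num.int) = (n%:Z %| m)%Z.
Proof.
move=> n_gt0; apply/idP/idP => [/intrP[k kE]|]; last exact: Qint_dvdz.
have n_neq0 : n%:R != 0 :> rat by rewrite pnatr_eq0 -lt0n.
have := canRL (divfK n_neq0) kE; rewrite pmulrn -rmorphM => /intr_inj ->.
exact: dvdz_mull.
Qed.

Theorem theorem1 (R : realType) (N : nat) (hN : (4 <= N)%N)
    (p : int) (hp : p \notin [:: 0; 1; -1]) (a b : R) (hab : a * b != 0) :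
  (exists kappa : nat -> R,
     equations_of_motion (@force_coef R N kappa)
       (@choreography R N (limacon p a b)))
  <->
  [/\ (p%:~R / N%:R : rat) \isn't a Num.int,
      ((p + 1)%:~R / N%:R : rat) \isn't a Num.int &
      ((p - 1)%:~R / N%:R : rat) \isn't a Num.int].
Proof.
have N_gt0 : (0 < N)%N by apply: leq_trans hN.
have [a0 b0] : a != 0 /\ b != 0 by apply/andP; rewrite -negb_or -mulf_eq0.
move: hp; rewrite !inE !negb_or => /and3P[p0 p1 pN1].
have eomE kappa := equations_of_motion_limacon kappa N_gt0 p1 a0 b0.
rewrite !Qint_divz //; split=> [[kappa /eomE[l1 lp]]|[pN pDN pBN]].
  (* Each congruence forces the eigenvalue p^2 to be 0 or 1. *)
  have p2_neq0 : p%:~R ^+ 2 != 0 :> R by rewrite expf_neq0 // intr_eq0.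
  have p2_neq1 : p%:~R ^+ 2 != 1 :> R.
    by rewrite sqrf_eq1 negb_or -[1]/(1%:~R) -mulrNz !eqr_int p1.
  split; apply/negP => Np.
  - move/eqP: p2_neq0; apply.
    rewrite -lp (@circ_eig_dvdz _ _ _ p 0) ?subr0 // /circ_eig big1 // => d _.
    by rewrite mul0r cos0 subrr mulr0.
  - move/eqP: p2_neq1; apply.
    by rewrite -lp (@circ_eig_dvdz _ _ _ p (- 1)) ?opprK // circ_eigN.
  - by move/eqP: p2_neq1; apply; rewrite -lp (@circ_eig_dvdz _ _ _ p 1).
have N1 : ~~ (N%:Z %| 1)%Z by rewrite dvdz1; lia.
have [|kappa eig] := @circ_eig_prescribe R N N_gt0 1 p 1 (p%:~R ^+ 2).
  by rewrite N1 pN addrC pDN -opprB rpredN pBN.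
by exists kappa; apply/eomE.
Qed.
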